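(* Every finite simple graph $G$ with at least one edge contains a set $S\subseteq V(G)$ which is a $1$-cheap set of $G$ and is of type I, type II or type III. Moreover, such a set can be found by a greedy algorithm.
   Context: For a vertex $v$, $\zeta(v)=\max_H\delta(H)$ over all subgraphs $H$ of $G$ containing $v$, where $\delta(H)$ is the minimum degree. $N[X]=X\cup\bigcup_{v\in X}N(v)$. A vertex $u$ is cheap in a graph $G$ if $\zeta_G(u)=\deg_G(u)$ and $\zeta_G(u)=\min_{v\in N[u]}\zeta_G(v)$. For an integer $k\geq0$, a $k$-cheap set of $G$ is either a subset of the isolated vertices of $G$, or a set $S$ of non-isolated vertices of $G$ such that (i) $\sum_{v\in N[S]}\frac{1}{\zeta(v)+\frac{1}{k+1}}\leq |S|$ and (ii) $\Delta(G[S])\leq k$. Type I: $S=\{u,w\}$ with $u,w$ adjacent cheap vertices of $G$. Type II: $S=\{u,w\}$ with $u,w$ adjacent, $u$ cheap in $G$, $u$ the only cheap vertex of $G$ adjacent to $w$, and $w$ cheap in $G\setminus u$. Type III: $S=\{u,w\}$ with $u,w$ non-adjacent cheap vertices of $G$ having at least one common neighbor. *)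

(* Defs.v *)
From HB Require Import structures.
From mathcomp Require Import all_boot all_order all_algebra.

Set Implicit Arguments.
Unset Strict Implicit.
Unset Printing Implicit Defensive.

Import Order.TTheory GRing.Theory Num.Theory.

Section Graphs.

Variable T : finType.
Implicit Types (X S P : {set T}) (u v w x : T).

(* The vertex set is an arbitrary subset of the ambient type [T], so that
   subgraphs and vertex-deleted graphs are again graphs over [T]. *)
Definition is_sgraph (p : {set T} * {set {set T}}) : bool :=
  [forall e in p.2, (#|e| == 2) && (e \subset p.1)].

Record sgraph := SGraph {
  sgraph_val : {set T} * {set {set T}};
  sgraph_axiom : is_sgraph sgraph_val
}.

HB.instance Definition _ := [isSub for sgraph_val].
HB.instance Definition _ := [Finite of sgraph by <:].

Implicit Types G H : sgraph.

Definition verts G : {set T} := (sgraph_val G).1.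
Definition edges G : {set {set T}} := (sgraph_val G).2.

Definition subgraph H G : bool :=
  (verts H \subset verts G) && (edges H \subset edges G).

Lemma induced_axiom G X :
  is_sgraph (verts G :&: X, [set e in edges G | e \subset X]).
Proof.
apply/'forall_implyP => e /=; rewrite inE => /andP[eG eX].
have /forallP/(_ e)/implyP/(_ eG)/andP[-> eV] := sgraph_axiom G.
by rewrite subsetI eV eX.
Qed.

Definition induced G X : sgraph := SGraph (induced_axiom G X).

Definition del_vertex G u : sgraph := induced G (verts G :\ u).

(* No loops: [set x; x] has cardinality 1, hence is never an edge. *)
Definition adj G u v : bool := [set u; v] \in edges G.

Definition nbhd G v : {set T} := [set w | adj G v w].

Definition closed_nbhd G X : {set T} := X :|: \bigcup_(v in X) nbhd G v.

Definition deg G v : nat := #|nbhd G v|.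

Definition isolated G v : bool := (v \in verts G) && (nbhd G v == set0).

(* The default value exceeds every degree, so for a nonempty graph this is the
   true minimum. *)
Definition min_degree H : nat := \big[minn/#|verts H|]_(v in verts H) deg H v.

Definition max_degree H : nat := \max_(v in verts H) deg H v.

Definition zeta G v : nat :=
  \max_(H : sgraph | subgraph H G && (v \in verts H)) min_degree H.

(* The default [zeta G u] of the minimum is harmless as u lies in N[u]. *)
Definition cheap G u : bool :=
  [&& u \in verts G,
      zeta G u == deg G u &
      zeta G u == \big[minn/zeta G u]_(v in closed_nbhd G [set u]) zeta G v].

Definition cheap_set (k : nat) G S : Prop :=
  (forall v, v \in S -> isolated G v) \/
  [/\ forall v, v \in S -> v \in verts G /\ ~~ isolated G v,
      (\sum_(v in closed_nbhd G S)
          1 / ((zeta G v)%:R + 1 / (k.+1)%:R) <= #|S|%:R :> rat)%R &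
      max_degree (induced G S) <= k].

Definition type_I G S : Prop :=
  exists u w, [/\ S = [set u; w], adj G u w, cheap G u & cheap G w].

Definition type_II G S : Prop :=
  exists u w,
    [/\ S = [set u; w], adj G u w, cheap G u,
        forall x, cheap G x -> adj G x w -> x = u &
        cheap (del_vertex G u) w].

Definition type_III G S : Prop :=
  exists u w,
    [/\ S = [set u; w], u != w /\ ~~ adj G u w, cheap G u, cheap G w &
        exists x, adj G u x /\ adj G w x].

(* Greedy rule, P being the set of vertices picked so far: pick a vertex of
   minimum degree in G \ P, preferring, among those, one of minimum degree
   in G. *)
Definition greedy_key_le G P w x : bool :=
  let d v := deg (induced G (verts G :\: P)) v in
  (d w < d x) || ((d w == d x) && (deg G w <= deg G x)).

Definition greedy_pick G P : option T :=
  [pick w in verts G :\: P | [forall x in verts G :\: P, greedy_key_le G P w x]].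

(* Picks are never revised.  The search stops at the first pick w that is at
   distance at most 2 in G from an earlier pick u, and returns {u, w}; an
   adjacent u has precedence over one that only shares a neighbor with w. *)
Fixpoint greedy_loop G (n : nat) P : option {set T} :=
  if n is n'.+1 then
    if greedy_pick G P is Some w then
      if [pick u in P | adj G u w] is Some u then Some [set u; w]
      else if [pick u in P | nbhd G u :&: nbhd G w != set0] is Some u
      then Some [set u; w]
      else greedy_loop G n' (w |: P)
    else None
  else None.

Definition greedy_search G : option {set T} := greedy_loop G #|verts G| set0.

End Graphs.

(* Main.v *)
Require Import Defs.
From mathcomp Require Import all_boot all_order all_algebra.
From mathcomp Require Import lra.

(** Let P be the set of picks made so far, pairwise at distance at least 3, let
    w be the next pick and d its degree in G \ P, so that every vertex of G \ P
    has [zeta] at least d.  If w has no neighbor in P, then its degree in G is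
    d and w is cheap.  Otherwise w has exactly one neighbor u in P, its degree
    in G is d + 1, and w is cheap in G \ u; if moreover w is adjacent to a cheap
    vertex x <> u, then the tie-breaking rule makes the degree of x at least
    d + 1, hence zeta(w) >= zeta(x) >= d + 1, and all neighbors of w lie in the
    subgraph witnessing this, so that w is cheap in G.  Thus two picks at
    distance at most 2 are of type I, II or III.  The sum condition holds because
    N[S] is a union of two sets A and B sharing a vertex, where |A| <= a + 1,
    |B| <= b + 1, zeta >= a on A and zeta >= b on B: if b <= a, the sum is at
    most (a + 1) / (a + 1/2) + b / (b + 1/2) <= 2. *)

Section CheapSets.
Set Implicit Arguments.
Unset Strict Implicit.
Unset Printing Implicit Defensive.
Import Order.TTheory GRing.Theory Num.Theory.

Variable T : finType.
Implicit Types (G H : sgraph T) (P S A B X Y : {set T}) (u v w x : T).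

(** * Adjacency, subgraphs and degrees *)

Lemma adjC G u v : adj G u v = adj G v u.
Proof. by rewrite /adj setUC. Qed.

Lemma adj_irrefl G u : adj G u u = false.
Proof.
apply/negP => uuG.
have /forallP/(_ _)/implyP/(_ uuG)/andP[] := sgraph_axiom G.
by rewrite setUid cards1.
Qed.

Lemma adj_neq G u v : adj G u v -> u != v.
Proof. by apply: contraTneq => ->; rewrite adj_irrefl. Qed.

Lemma adj_verts G u v : adj G u v -> (u \in verts G) && (v \in verts G).
Proof.
move=> uvG; have /forallP/(_ _)/implyP/(_ uvG)/andP[_] := sgraph_axiom G.
by rewrite subUset !sub1set.
Qed.

Lemma adj_subgraph H G u v : subgraph H G -> adj H u v -> adj G u v.
Proof. by case/andP=> _ /subsetP; apply. Qed.

Lemma induced_subgraph G X : subgraph (induced G X) G.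
Proof.
rewrite /subgraph subsetIl.
by apply/subsetP => e; rewrite inE => /andP[].
Qed.

Lemma verts_induced G X : verts (induced G X) = verts G :&: X.
Proof. by []. Qed.

Lemma adj_induced G X u v :
  adj (induced G X) u v = [&& adj G u v, u \in X & v \in X].
Proof. by rewrite /adj inE subUset !sub1set. Qed.

Lemma induced_subset G X Y :
  X \subset Y -> subgraph (induced G X) (induced G Y).
Proof.
move=> XY; rewrite /subgraph setIS //=.
apply/subsetP => e; rewrite !inE => /andP[-> eX].
exact: subset_trans XY.
Qed.

Lemma deg_subgraph H G v : subgraph H G -> deg H v <= deg G v.
Proof.
move=> HG; apply/subset_leq_card/subsetP => w; rewrite !inE.
exact: adj_subgraph.
Qed.

Lemma deg_lt_verts G v : v \in verts G -> deg G v < #|verts G|.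
Proof.
move=> vG; rewrite (cardsD1 v (verts G)) vG add1n ltnS.
apply/subset_leq_card/subsetP => w; rewrite !inE => vw.
by rewrite eq_sym (adj_neq vw); case/andP: (adj_verts vw).
Qed.

(** * Minima and the parameter [zeta] *)

Lemma bigmin_geq (I : finType) (Q : pred I) (F : I -> nat) m d :
  m <= d -> (forall i, Q i -> m <= F i) -> m <= \big[minn/d]_(i | Q i) F i.
Proof.
move=> md mF; elim/big_ind: _ => // x y mx my.
by rewrite leq_min mx.
Qed.

Lemma bigmin_leq (I : finType) (Q : pred I) (F : I -> nat) d i :
  Q i -> \big[minn/d]_(i | Q i) F i <= F i.
Proof.
move=> Qi; rewrite unlock; have := mem_index_enum i.
elim: (index_enum I) => //= j s IHs; rewrite inE => /predU1P[<-|/IHs le_s].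
  by rewrite Qi geq_minl.
by case: (Q j); rewrite // geq_min le_s orbT.
Qed.

Lemma leq_zeta H G v k : subgraph H G -> v \in verts H ->
  (forall x, x \in verts H -> k <= deg H x) -> k <= zeta G v.
Proof.
move=> HG vH kH; apply: leq_trans (leq_bigmax_cond _ _); last first.
  by apply/andP; split; [exact: HG | exact: vH].
(* The default value [#|verts H|] must also be at least [k]; it is, since the degree of [v] in [H]
   lies between the two. *)
by apply: bigmin_geq => //; rewrite (leq_trans (kH v vH)) // ltnW ?deg_lt_verts.
Qed.

Lemma zeta_witness G v : v \in verts G -> exists H,
  [/\ subgraph H G, v \in verts H &
      forall x, x \in verts H -> zeta G v <= deg H x].
Proof.
move=> vG; pose Q := [pred H | subgraph H G && (v \in verts H)].
have cQ : 0 < #|Q|.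
  by apply/card_gt0P; exists G; rewrite !inE /subgraph !subxx.
have [H /andP[HG vH] zH] := eq_bigmax_cond (@min_degree T) cQ.
exists H; split=> // x xH; rewrite /zeta [X in X <= _]zH.
exact: bigmin_leq.
Qed.

Lemma zeta_leq_deg G v : v \in verts G -> zeta G v <= deg G v.
Proof.
case/zeta_witness => H [HG vH /(_ v vH)] /leq_trans; apply.
exact: deg_subgraph.
Qed.

(** * Closed neighborhoods and cheap vertices *)

Lemma mem_closed_nbhd1 G u v : v \in closed_nbhd G [set u] = (v == u) || adj G u v.
Proof. by rewrite /closed_nbhd big_set1 !inE. Qed.

Lemma closed_nbhd2 G u w :
  closed_nbhd G [set u; w] = closed_nbhd G [set u] :|: closed_nbhd G [set w].
Proof.
rewrite /closed_nbhd bigcup_setU !big_set1 -!setUA; congr (_ :|: _).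
exact: setUCA.
Qed.

Lemma card_closed_nbhd1 G u : #|closed_nbhd G [set u]| = (deg G u).+1.
Proof. by rewrite /closed_nbhd big_set1 cardsU1 inE adj_irrefl. Qed.

Lemma cheap_intro G u : u \in verts G -> deg G u <= zeta G u ->
  (forall v, adj G u v -> deg G u <= zeta G v) -> cheap G u.
Proof.
move=> uG du dN; have zu : zeta G u = deg G u.
  by apply/eqP; rewrite eqn_leq du zeta_leq_deg.
apply/and3P; split; rewrite ?zu // eqn_leq.
apply/andP; split; last first.
  by rewrite -{2}zu; apply: bigmin_leq; rewrite mem_closed_nbhd1 eqxx.
apply: bigmin_geq => // v; rewrite mem_closed_nbhd1 => /predU1P[->|/dN //].
by rewrite zu.
Qed.

Lemma cheap_verts G u : cheap G u -> u \in verts G.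
Proof. by case/and3P. Qed.

Lemma cheap_zeta G u : cheap G u -> zeta G u = deg G u.
Proof. by case/and3P=> _ /eqP. Qed.

Lemma cheap_closed_nbhd G u v :
  cheap G u -> v \in closed_nbhd G [set u] -> deg G u <= zeta G v.
Proof.
move=> cu vN; rewrite -(cheap_zeta cu); case/and3P: cu => _ _ /eqP ->.
exact: bigmin_leq.
Qed.

(** A subgraph attaining [zeta G w] gives [w] full degree, so it contains every neighbor of [w]. It
    therefore bounds [zeta] from below at those neighbors too, and the minimality over N[w] comes
    for free. *)
Lemma cheap_of_zeta G w : w \in verts G -> deg G w <= zeta G w -> cheap G w.
Proof.
move=> wG dz; apply: cheap_intro => // v wv.
have [H [HG wH zH]] := zeta_witness wG.
have nbhdE : nbhd H w = nbhd G w.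
  apply/eqP; rewrite eqEcard (leq_trans dz (zH w wH)) andbT.
  by apply/subsetP => x; rewrite !inE; apply: adj_subgraph.
have wvH : adj H w v by move/setP/(_ v): nbhdE; rewrite !inE wv.
apply: (leq_zeta HG) => [|x xH]; first by case/andP: (adj_verts wvH).
exact: leq_trans dz (zH x xH).
Qed.

(** * The sum condition, and pairs that are 1-cheap sets *)

Section SumBound.
Local Open Scope ring_scope.

Lemma sum_le_const (R : realFieldType) A (F : T -> R) c (n : nat) : 0 <= c ->
  (#|A| <= n)%N -> {in A, forall v, F v <= c} -> \sum_(v in A) F v <= n%:R * c.
Proof.
move=> c0 An Fc; apply: (le_trans (ler_sum _ Fc)).
by rewrite sumr_const -[X in X <= _]mulr_natl ler_wpM2r // ler_nat.
Qed.

Lemma sum_inv_setU (R : realFieldType) A B (f : T -> nat) (a b : nat) x :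
  x \in A -> x \in B -> (#|A| <= a.+1)%N -> (#|B| <= b.+1)%N ->
  {in A, forall v, a <= f v}%N -> {in B, forall v, b <= f v}%N ->
  \sum_(v in A :|: B) 1 / ((f v)%:R + 1 / 2%:R) <= 2%:R :> R.
Proof.
(* By symmetry, the shared vertex can be charged to the side with the larger lower bound on [f],
   where the bound on each term is smaller. *)
wlog ba : A B a b / (b <= a)%N => [IH|] xA xB Aa Bb fA fB.
  case/orP: (leq_total b a) => ab; first exact: (IH A B a b).
  by rewrite setUC; apply: (IH B A b a).
have half_gt0 (n : nat) : 0 < n%:R + 1 / 2%:R :> R.
  by rewrite ltr_wpDl ?ler0n // divr_gt0 ?ltr0n.
have term_le (n m : nat) : (n <= m)%N ->
    1 / (m%:R + 1 / 2%:R) <= 1 / (n%:R + 1 / 2%:R) :> R.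
  move=> nm; apply: ler_wpM2l => //.
  by rewrite lef_pV2 ?lerD2r ?ler_nat // posrE; apply: half_gt0.
have term_ge0 (n : nat) : 0 <= 1 / (n%:R + 1 / 2%:R) :> R.
  by rewrite divr_ge0 // ltW.
rewrite (bigID (mem A)) /=.
have -> : \sum_(v in A :|: B | v \in A) 1 / ((f v)%:R + 1 / 2%:R) =
          \sum_(v in A) 1 / ((f v)%:R + 1 / 2%:R) :> R.
  by apply: eq_bigl => v; rewrite inE andbC; case: (v \in A).
have -> : \sum_(v in A :|: B | v \notin A) 1 / ((f v)%:R + 1 / 2%:R) =
          \sum_(v in B :\: A) 1 / ((f v)%:R + 1 / 2%:R) :> R.
  by apply: eq_bigl => v; rewrite !inE andbC; case: (v \in A).
(* The shared vertex [x] is what lowers the count from [b.+1] to [b]. *)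
have BAb : (#|B :\: A| <= b)%N.
  rewrite -ltnS; apply: leq_trans Bb; apply: proper_card.
  by apply/properP; split; [exact: subsetDl | exists x; rewrite // inE xA].
have leA := sum_le_const (term_ge0 a) Aa (fun v vA => term_le _ _ (fA v vA)).
have leB : \sum_(v in B :\: A) 1 / ((f v)%:R + 1 / 2%:R) <=
           b%:R * (1 / (b%:R + 1 / 2%:R)) :> R.
  apply: sum_le_const => // v; rewrite inE => /andP[_ vB].
  exact/term_le/fB.
have frac (n : nat) : n%:R * (1 / (n%:R + 1 / 2%:R)) =
    1 - 1 / 2%:R * (1 / (n%:R + 1 / 2%:R)) :> R.
  apply/eqP; rewrite eq_sym subr_eq -mulrDl ![_ * (1 / _)]mulrA mulr1 mulfV //.
  exact: lt0r_neq0 (half_gt0 n).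
apply: (le_trans (lerD leA leB)); have := term_le _ _ ba.
(* With [ia] and [ib] the reciprocals of a + 1/2 and b + 1/2, the bound becomes 2 + (ia - ib) / 2,
   and [ia <= ib] because [b <= a]. *)
rewrite -[a.+1%:R]natr1 mulrDl !frac.
move: (1 / (a%:R + _)) (1 / (b%:R + _)) => ia ib iab; lra.
Qed.

End SumBound.

(** [A] and [B] are kept free of the closed neighborhoods of [u] and [w]: for two adjacent picks,
    the earlier one has to be counted on its own side only. *)
Lemma cheap_set_pair G u w A B a b x : u != w ->
  u \in verts G -> ~~ isolated G u -> w \in verts G -> ~~ isolated G w ->
  closed_nbhd G [set u; w] = A :|: B -> x \in A -> x \in B ->
  #|A| <= a.+1 -> #|B| <= b.+1 ->
  {in A, forall v, a <= zeta G v} -> {in B, forall v, b <= zeta G v} ->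
  cheap_set 1 G [set u; w].
Proof.
move=> uw uG uI wG wI NE xA xB Aa Bb zA zB; right; split.
- by move=> v; rewrite !inE => /orP[] /eqP ->.
- by rewrite NE cards2 uw; apply: sum_inv_setU xA xB Aa Bb zA zB.
(* A graph on at most two vertices has maximum degree at most 1. *)
apply/bigmax_leqP => v /deg_lt_verts dv; rewrite -ltnS (leq_trans dv) //.
rewrite verts_induced (leq_trans (subset_leq_card (subsetIr _ _))) //.
by rewrite cards2 uw.
Qed.

Lemma adj_nonisolated G u v : adj G u v -> ~~ isolated G u.
Proof.
move=> uv; rewrite negb_and; apply/orP; right; apply/set0Pn; exists v.
by rewrite inE.
Qed.

Lemma cheap_set_cheap_pair G u w x : u != w ->
  cheap G u -> ~~ isolated G u -> cheap G w -> ~~ isolated G w ->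
  x \in closed_nbhd G [set u] -> x \in closed_nbhd G [set w] ->
  cheap_set 1 G [set u; w].
Proof.
move=> uw cu uI cw wI xu xw.
apply: (cheap_set_pair (a := deg G u) (b := deg G w) (x := x)
    uw _ uI _ wI (closed_nbhd2 G u w));
  rewrite ?cheap_verts ?card_closed_nbhd1 // => v.
- exact: cheap_closed_nbhd.
exact: cheap_closed_nbhd.
Qed.

(** * The residual graph and the greedy choice *)

Definition residual G P : sgraph T := induced G (verts G :\: P).

(** The invariant of the greedy loop; the last clause expresses pairwise distance at least 3. *)
Definition scattered_cheap G P :=
  [/\ P \subset verts G, {in P, forall u, cheap G u} &
      {in P &, forall u v, u != v ->
         ~~ adj G u v && (nbhd G u :&: nbhd G v == set0)}].

Lemma nbhd_residual G P v :
  v \in verts G :\: P -> nbhd (residual G P) v = nbhd G v :\: P.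
Proof.
move=> vP; apply/setP => x; rewrite inE adj_induced vP /= !inE.
case vx: (adj G v x); rewrite ?andbF //=.
by case/andP: (adj_verts vx) => _ ->; rewrite !andbT.
Qed.

Lemma greedy_pick_exists G P :
  verts G :\: P != set0 -> exists w, greedy_pick G P = Some w.
Proof.
case/set0Pn => x0 x0P; rewrite /greedy_pick; case: pickP => [w _|no_min].
  by exists w.
pose d := deg (residual G P).
(* The key is lexicographic: [x1] minimises the residual degree, then [w] minimises the degree in
   [G] among all such minimisers. *)
have [x1 x1P min1] := arg_minnP d x0P.
have Q1 : (x1 \in verts G :\: P) && (d x1 == d x1) by apply/andP.
pose Q x := (x \in verts G :\: P) && (d x == d x1).
have [w /andP[wP /eqP dw] min2] := @arg_minnP _ x1 Q (deg G) Q1.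
case/negP: (negbT (no_min w)); rewrite wP /=.
apply/'forall_implyP => x xP; rewrite /greedy_key_le -/(residual G P).
rewrite -/(d w) -/(d x) dw; have := min1 x xP.
rewrite leq_eqVlt => /orP[/eqP dx|->//]; rewrite -dx eqxx /=.
by rewrite min2 ?orbT // /Q xP dx eqxx.
Qed.

Lemma greedy_pickP G P w : greedy_pick G P = Some w ->
  w \in verts G :\: P /\ {in verts G :\: P, forall x, greedy_key_le G P w x}.
Proof.
rewrite /greedy_pick; case: pickP => // y /andP[yP /'forall_implyP le_y] [<-].
by split.
Qed.

(** * One step of the greedy search *)

Section GreedyStep.
Variables (G : sgraph T) (P : {set T}) (w : T).
Hypotheses (scP : scattered_cheap G P) (pick_w : greedy_pick G P = Some w).

Let d := deg (residual G P) w.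

Lemma pick_verts : w \in verts G.
Proof. by case/setDP: (greedy_pickP pick_w).1. Qed.

Lemma pick_fresh : w \notin P.
Proof. by case/setDP: (greedy_pickP pick_w).1. Qed.

(** The residual graph has minimum degree [d] and is itself the witness. [H] is arbitrary so as to
    cover both [G] and [G] with the neighboring pick deleted. *)
Lemma leq_zeta_pick H x :
  subgraph (residual G P) H -> x \in verts G :\: P -> d <= zeta H x.
Proof.
move=> GH xP; apply: (leq_zeta GH).
  by rewrite verts_induced inE xP andbT; case/setDP: xP.
move=> y; rewrite verts_induced inE => /andP[_ yP].
case: (greedy_pickP pick_w) => _ /(_ y yP).
by case/orP=> [/ltnW|/andP[/eqP e _]]; rewrite /d ?e.
Qed.

Lemma deg_pick : deg G w = #|nbhd G w :&: P| + d.
Proof. by rewrite /d /deg nbhd_residual ?(greedy_pickP pick_w).1 // cardsID. Qed.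

Lemma pick_cheap : (forall u, u \in P -> ~~ adj G u w) -> cheap G w.
Proof.
move=> nadj; have wE : deg G w = d.
  rewrite deg_pick (_ : nbhd G w :&: P = set0) ?cards0 //.
  apply/setP => x; rewrite !inE andbC adjC.
  by case xP: (x \in P) => //=; apply/negbTE/nadj.
apply: cheap_of_zeta; first exact: pick_verts.
by rewrite wE leq_zeta_pick ?induced_subgraph ?(greedy_pickP pick_w).1.
Qed.

Section Adjacent.
Variable u : T.
Hypotheses (uP : u \in P) (uw : adj G u w).

(** Two distinct neighbors of [w] in [P] would have [w] as a common neighbor, against the
    invariant. *)
Lemma pick_nbr_uniq x : x \in P -> adj G x w -> x = u.
Proof.
case: scP => _ _ sc xP xw; apply/eqP; apply/negP => /negP xu.
case/andP: (sc x u xP uP xu) => _ /eqP/setP/(_ w).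
by rewrite !inE xw uw.
Qed.

Lemma deg_pick_adj : deg G w = d.+1.
Proof.
rewrite deg_pick (_ : nbhd G w :&: P = [set u]) ?cards1 //.
apply/setP => x; rewrite !inE adjC; apply/andP/eqP => [[xw xP]|->//].
exact: pick_nbr_uniq.
Qed.

Lemma pick_nbr_residual v : adj G w v -> v != u -> v \in verts G :\: P.
Proof.
move=> wv vu; rewrite inE; case/andP: (adj_verts wv) => _ ->; rewrite andbT.
by apply: contra vu => vP; rewrite (pick_nbr_uniq vP) // adjC.
Qed.

Lemma pick_cheap_del : cheap (del_vertex G u) w.
Proof.
have sub : subgraph (residual G P) (del_vertex G u).
  apply: induced_subset; apply/subsetP => x; rewrite !inE => /andP[xP ->].
  by rewrite andbT; apply: contraNneq xP => ->.
have wP := (greedy_pickP pick_w).1.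
have wu : w != u by rewrite eq_sym (adj_neq uw).
(* Apart from [u], all neighbors of [w] lie outside [P]. *)
have wd : deg (del_vertex G u) w <= d.
  apply/subset_leq_card/subsetP => x; rewrite !inE !adj_induced wP.
  by case/and3P=> wx _ /setD1P[xu _]; rewrite wx pick_nbr_residual.
apply: cheap_of_zeta; last exact: leq_trans wd (leq_zeta_pick sub wP).
by rewrite verts_induced !inE wu pick_verts.
Qed.

Lemma pick_cheap_of_nbr x : cheap G x -> adj G x w -> x != u -> cheap G w.
Proof.
move=> cx xw xu; apply: cheap_of_zeta pick_verts _.
have xP : x \in verts G :\: P by apply: pick_nbr_residual; rewrite // adjC.
(* Either the residual degree of [x] already exceeds [d], or it ties with that of [w] and the
   tie-break puts the degree of [x] in [G] at or above that of [w], which is [d.+1]. *)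
have dx : d < deg G x.
  case: (greedy_pickP pick_w) => _ /(_ x xP); rewrite /greedy_key_le.
  case/orP => [lt_wx|/andP[_]]; last by rewrite deg_pick_adj.
  by apply: leq_trans lt_wx _; apply/deg_subgraph/induced_subgraph.
rewrite deg_pick_adj (leq_trans dx) // (cheap_closed_nbhd cx) //.
by rewrite mem_closed_nbhd1 xw orbT.
Qed.

Lemma pick_adj_cheap_set : cheap_set 1 G [set u; w].
Proof.
have cu : cheap G u by case: scP => _ cP _; apply: cP.
have wu : adj G w u by rewrite adjC.
(* N[w] has d + 2 elements, and [u] is the one vertex in it to which the residual bound [d] on
   [zeta] need not apply. Without [u] it has d + 1 elements, and it still meets N[u] in [w]. *)
apply: (cheap_set_pair (A := closed_nbhd G [set u]) (a := deg G u)
    (B := closed_nbhd G [set w] :\ u) (b := d) (x := w) (adj_neq uw)).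
- exact: cheap_verts.
- exact: adj_nonisolated uw.
- exact: pick_verts.
- exact: adj_nonisolated wu.
- rewrite closed_nbhd2; apply/setP => v; rewrite !inE.
  by case: (v =P u) => [->|]; rewrite //= !mem_closed_nbhd1 eqxx.
- by rewrite mem_closed_nbhd1 uw orbT.
- by rewrite inE mem_closed_nbhd1 eqxx inE eq_sym (adj_neq uw).
- by rewrite card_closed_nbhd1.
- rewrite -ltnS -deg_pick_adj -card_closed_nbhd1.
  by rewrite [X in _ < X](cardsD1 u) mem_closed_nbhd1 wu orbT add1n ltnS.
- by move=> v; apply: cheap_closed_nbhd.
move=> v; rewrite inE inE mem_closed_nbhd1 => /andP[vu /predU1P[->|wv]].
  by rewrite leq_zeta_pick ?induced_subgraph ?(greedy_pickP pick_w).1.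
by rewrite leq_zeta_pick ?induced_subgraph ?pick_nbr_residual.
Qed.

Lemma pick_adj_type : type_I G [set u; w] \/ type_II G [set u; w].
Proof.
have cu : cheap G u by case: scP => _ cP _; apply: cP.
(* A second cheap neighbor would make [w] cheap in [G], so failing type I forces the uniqueness
   clause of type II. *)
case cw: (cheap G w); [left | right]; exists u, w; split=> //.
  move=> x cx xw; apply: contraFeq cw => xu.
  exact: pick_cheap_of_nbr cx xw xu.
exact: pick_cheap_del.
Qed.

End Adjacent.

Lemma scattered_cheap_pick : (forall u, u \in P -> ~~ adj G u w) ->
  (forall u, u \in P -> nbhd G u :&: nbhd G w == set0) ->
  scattered_cheap G (w |: P).
Proof.
move=> nadj ncom; case: scP => PV cP sc; split.
- by rewrite subUset sub1set pick_verts.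
- by move=> v /setU1P[->|/cP //]; apply: pick_cheap.
move=> v x /setU1P[->|vP] /setU1P[->|xP] vx.
- by rewrite eqxx in vx.
- by rewrite adjC setIC nadj // ncom.
- by rewrite nadj // ncom.
exact: sc.
Qed.

End GreedyStep.

(** * Termination and correctness of the search *)

Lemma scattered_cheap_not_cover G P :
  edges G != set0 -> scattered_cheap G P -> verts G :\: P != set0.
Proof.
case/set0Pn => e eG [_ _ sc]; apply/negP => /eqP VP.
have /forallP/(_ e)/implyP/(_ eG)/andP[+ eV] := sgraph_axiom G.
case/cards2P => x [y [xy eE]].
(* If [P] covered all vertices, both ends of an edge would be picks, yet picks are pairwise
   non-adjacent. *)
have VsP : verts G \subset P by rewrite -setD_eq0 VP.
move: eV; rewrite eE subUset !sub1set.
case/andP => /(subsetP VsP) xP /(subsetP VsP) yP.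
by case/andP: (sc x y xP yP xy); rewrite /adj -eE eG.
Qed.

(** The fuel [n] bounds the number of unpicked vertices, which drops with each pick. It cannot run
    out: at [n = 0] the picks would cover the graph, which an edge rules out. *)
Lemma greedy_loop_correct G n P : edges G != set0 -> scattered_cheap G P ->
  #|verts G :\: P| <= n -> exists S,
  [/\ greedy_loop G n P = Some S, S \subset verts G, cheap_set 1 G S &
      type_I G S \/ type_II G S \/ type_III G S].
Proof.
move=> hG; elim: n P => [|n IHn] P scP.
  by rewrite leqn0 cards_eq0 (negPf (scattered_cheap_not_cover hG scP)).
move=> szP /=; have [w pw] := greedy_pick_exists (scattered_cheap_not_cover hG scP).
have wG := pick_verts pw; have [PV cP _] := scP.
rewrite pw; case: pickP => [u /andP[uP uw]|nadj].
  exists [set u; w]; split=> //.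
  - by rewrite subUset !sub1set (subsetP PV).
  - exact: pick_adj_cheap_set scP pw _ uP uw.
  by case: (pick_adj_type scP pw uP uw); auto.
have {}nadj u : u \in P -> ~~ adj G u w.
  by move=> uP; have := nadj u; rewrite uP /= => ->.
have cw := pick_cheap pw nadj.
case: pickP => [u /andP[uP /set0Pn[x]]|ncom].
  rewrite !inE => /andP[ux wx]; have cu := cP u uP.
  have uw : u != w by apply: contraNneq (pick_fresh pw) => <-.
  exists [set u; w]; split=> //.
  - by rewrite subUset !sub1set (subsetP PV).
  - apply: (cheap_set_cheap_pair (x := x) uw cu _ cw).
    + exact: adj_nonisolated ux.
    + exact: adj_nonisolated wx.
    + by rewrite mem_closed_nbhd1 ux orbT.
    by rewrite mem_closed_nbhd1 wx orbT.
  by right; right; exists u, w; split=> //; [split=> //; exact: nadj | exists x].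
apply: IHn.
  apply: scattered_cheap_pick => // u uP.
  by have := ncom u; rewrite uP /= => /negbFE.
rewrite setUC setDUr -ltnS; apply: leq_trans szP; apply: proper_card.
have wP := (greedy_pickP pw).1.
apply/properP; split; first exact: subsetIl.
by exists w => //; rewrite !inE eqxx andbF.
Qed.

End CheapSets.

Theorem theorem4 (T : finType) (G : sgraph T) (hG : edges G != set0) :
  (exists S : {set T},
      [/\ S \subset verts G, cheap_set 1 G S &
          type_I G S \/ type_II G S \/ type_III G S]) /\
  (exists S : {set T},
      [/\ greedy_search G = Some S, S \subset verts G, cheap_set 1 G S &
          type_I G S \/ type_II G S \/ type_III G S]).
Proof.
have sc0 : scattered_cheap G set0.
  by split=> [|u|u v]; rewrite ?sub0set ?inE.
have [|S [gS SV cS tS]] := @greedy_loop_correct T G #|verts G| set0 hG sc0.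
  by rewrite setD0.
by split; exists S.
Qed.
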